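(* Let $A$ be the class of $(P_2+P_3)$-free bipartite graphs. For all integers $p,q\ge 2$, $$R^b_A(p,q)=\max\{p,q\}+p+q-2.$$
   Context: All graphs are finite and simple. $P_n$ is the chordless path on $n$ vertices and $P_2+P_3$ is the disjoint union of $P_2$ and $P_3$. A graph is $H$-free if it contains no induced subgraph isomorphic to $H$. A bipartite graph $G=(B,W,E)$ is given together with a bipartition $B\cup W$ of its vertex set into two independent sets (its parts). The bipartite complement $\widetilde{G}$ of $G$ is the bipartite graph on the same vertex set and with the same parts in which $x\in B$ and $y\in W$ are adjacent if and only if they are not adjacent in $G$. $K_{n,n}$ is the complete bipartite graph with $n$ vertices in each part. For a class $X$ of bipartite graphs, $R^b_X(p,q)$ is the minimum $n$ such that every $G\in X$ with at least $n$ vertices in each of the parts satisfies: $G$ contains $K_{p,p}$ as an induced subgraph or $\widetilde{G}$ contains $K_{q,q}$ as an induced subgraph. *)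

(* Defs.v *)
From mathcomp Require Import all_boot.
Set Implicit Arguments.
Unset Strict Implicit.
Unset Printing Implicit Defensive.

Record sgraph := SGraph {
  vertex :> finType;
  adj : rel vertex;
  adj_sym : symmetric adj;
  adj_irrefl : irreflexive adj }.

Definition isomorphic (G H : sgraph) : Prop :=
  exists2 f : G -> H, bijective f & forall x y, adj (f x) (f y) = adj x y.

Section Induced.
Variables (G : sgraph) (S : {set G}).
Definition induced_adj : rel {x : G | x \in S} :=
  fun u v => adj (val u) (val v).
Fact induced_sym : symmetric induced_adj.
Proof. by move=> u v; apply: adj_sym. Qed.
Fact induced_irrefl : irreflexive induced_adj.
Proof. by move=> u; apply: adj_irrefl. Qed.
Definition induced : sgraph := SGraph induced_sym induced_irrefl.
End Induced.

Definition contains_induced (G H : sgraph) : Prop :=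
  exists S : {set G}, isomorphic (induced S) H.

Definition free (H G : sgraph) : Prop := ~ contains_induced G H.

Section PathGraph.
Variable n : nat.
Definition path_adj : rel 'I_n := fun i j => (i.+1 == j) || (j.+1 == i).
Fact path_sym : symmetric path_adj.
Proof. by move=> i j; apply: orbC. Qed.
Fact path_irrefl : irreflexive path_adj.
Proof. by move=> i; rewrite /path_adj orbb gtn_eqF. Qed.
(* n is the number of vertices *)
Definition path_graph : sgraph := SGraph path_sym path_irrefl.
End PathGraph.

Section DisjointUnion.
Variables G H : sgraph.
Definition union_adj : rel (G + H)%type := fun u v =>
  match u, v with
  | inl x, inl y => adj x y
  | inr x, inr y => adj x y
  | _, _ => false
  end.
Fact union_sym : symmetric union_adj.
Proof. by case=> x [] y //=; apply: adj_sym. Qed.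
Fact union_irrefl : irreflexive union_adj.
Proof. by case=> x /=; apply: adj_irrefl. Qed.
Definition disjoint_union : sgraph := SGraph union_sym union_irrefl.
End DisjointUnion.

Section CompleteBipartite.
Variables m n : nat.
Definition biclique_adj : rel ('I_m + 'I_n)%type := fun u v =>
  match u, v with
  | inl _, inr _ | inr _, inl _ => true
  | _, _ => false
  end.
Fact biclique_sym : symmetric biclique_adj.
Proof. by case=> x []. Qed.
Fact biclique_irrefl : irreflexive biclique_adj.
Proof. by case. Qed.
Definition biclique : sgraph := SGraph biclique_sym biclique_irrefl.
End CompleteBipartite.

Definition independent (G : sgraph) (S : {set G}) : Prop :=
  {in S &, forall x y, ~~ adj x y}.

(* The bipartition is part of the data; a part may be empty. *)
Record bigraph := BiGraph {
  graph_of :> sgraph;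
  black : {set graph_of};
  white : {set graph_of};
  parts_cover : black :|: white = setT;
  parts_disjoint : [disjoint black & white];
  black_independent : independent black;
  white_independent : independent white }.

Section BipartiteComplement.
Variable G : bigraph.
Definition bicompl_adj : rel G := fun x y =>
  ((x \in black G) && (y \in white G) || (x \in white G) && (y \in black G))
  && ~~ adj x y.
Fact bicompl_sym : symmetric bicompl_adj.
Proof.
move=> x y; rewrite /bicompl_adj adj_sym; congr (_ && _).
by rewrite orbC; congr (_ || _); apply: andbC.
Qed.
Fact bicompl_irrefl : irreflexive bicompl_adj.
Proof.
move=> x; rewrite /bicompl_adj [(x \in white G) && _]andbC orbb.
case: (boolP (x \in black G)) => // xB.
by rewrite (disjointFr (parts_disjoint G) xB).
Qed.
Definition bicompl_graph : sgraph := SGraph bicompl_sym bicompl_irrefl.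
Fact bicompl_black_independent :
  independent (black G : {set bicompl_graph}).
Proof.
move=> x y xB yB; rewrite /= /bicompl_adj.
by rewrite !(disjointFr (parts_disjoint G)) // andbF.
Qed.
Fact bicompl_white_independent :
  independent (white G : {set bicompl_graph}).
Proof.
move=> x y xW yW; rewrite /= /bicompl_adj.
by rewrite !(disjointFl (parts_disjoint G)) // andbF.
Qed.
Definition bicompl : bigraph :=
  @BiGraph bicompl_graph (black G) (white G) (parts_cover G)
    (parts_disjoint G) bicompl_black_independent bicompl_white_independent.
End BipartiteComplement.

Definition bipartite_Ramsey_bound (X : bigraph -> Prop) (p q n : nat) : Prop :=
  forall G : bigraph, X G -> n <= #|black G| -> n <= #|white G| ->
    contains_induced G (biclique p p) \/
    contains_induced (bicompl G) (biclique q q).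

(* The minimum need not exist for an arbitrary class X, so R^b_X(p,q) = n is
   a relation: n is the least bound. *)
Definition is_bipartite_Ramsey_number
    (X : bigraph -> Prop) (p q n : nat) : Prop :=
  bipartite_Ramsey_bound X p q n /\
  forall m, bipartite_Ramsey_bound X p q m -> n <= m.

Definition P2P3_free_bipartite (G : bigraph) : Prop :=
  free (disjoint_union (path_graph 2) (path_graph 3)) G.

(* Main.v *)
(* In a (P2+P3)-free bipartite graph two vertices of the same part have either
   nested neighbourhoods or neighbourhoods differing by the exchange of a single
   vertex.  Hence the vertices of one part are ordered by degree, a smaller
   degree giving a smaller neighbourhood, and the neighbourhoods of the vertices
   of a given degree are all equal, or of the form K + f(z), or of the form
   U - f(z), with f injective.  If neither biclique occurs, some degree d has
   fewer than q vertices below it, fewer than p above it, and at least q of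
   degree at most d; counting common neighbours of the p highest vertices and
   common non-neighbours of the q lowest ones then bounds the part sizes.
   For sharpness, take a perfect matching on 2q - 1 edges and add p - 2 vertices
   to each part, adjacent to the whole other part; if p > q, use the bipartite
   complement of that graph with p and q exchanged. *)
Require Import Defs.
From mathcomp Require Import all_boot.
From mathcomp Require Import zify.
From Stdlib Require Import Classical_Prop.
Set Implicit Arguments.
Unset Strict Implicit.
Unset Printing Implicit Defensive.

(** * Induced subgraphs of bipartite graphs in terms of adjacency *)

Lemma contains_inducedP (G H : sgraph) :
  contains_induced G H <->
  exists2 g : H -> G, injective g & forall x y, adj (g x) (g y) = adj x y.
Proof.
split=> [[S [f [f' fK f'K] fadj]] | [g g_inj gadj]].
  exists (fun x => val (f' x)) => [|x y].
    exact: inj_comp val_inj (can_inj f'K).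
  by rewrite -[x in RHS]f'K -[y in RHS]f'K fadj.
have imP (x : {x : G | x \in g @: setT}) : exists y, g y == val x.
  by case/imsetP: (valP x) => y _ ->; exists y.
exists (g @: setT), (fun x => xchoose (imP x)) => [|x y].
  have im y : g y \in g @: setT by apply: imset_f.
  exists (fun y => exist _ (g y) (im y)) => x.
    by apply/val_inj/eqP; apply: (xchooseP (imP x)).
  by apply: g_inj; apply/eqP; apply: (xchooseP (imP _)).
by rewrite -gadj (eqP (xchooseP (imP x))) (eqP (xchooseP (imP y))).
Qed.

Lemma white_notin_black (G : bigraph) (x : G) :
  (x \in white G) = (x \notin black G).
Proof.
have := in_setT x; rewrite -(parts_cover G) in_setU.
by case: (boolP (x \in black G)) => // /(disjointFr (parts_disjoint G)) ->.
Qed.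

Lemma adj_black (G : bigraph) (x y : G) :
  adj x y -> (x \in black G) = (y \notin black G).
Proof.
move=> xy; case: (boolP (x \in black G)) (boolP (y \in black G)).
  by move=> xB [] // yB; have := black_independent xB yB; rewrite xy.
move=> + [] //; rewrite -!white_notin_black => xW yW.
by have := white_independent xW yW; rewrite xy.
Qed.

Lemma same_part_nadj (G : bigraph) (x y : G) :
  (x \in black G) = (y \in black G) -> adj x y = false.
Proof. by move=> xy; apply/negP => /adj_black; rewrite xy; case: (y \in _). Qed.

(** Here [x] is the centre of a P3 with ends [u1], [u2], and [y], [v] span a P2. The hypotheses and
    the parts exclude all other edges between them except [x v]. *)
Lemma P2P3_freeP (G : bigraph) :
  P2P3_free_bipartite G <->
  forall x y u1 u2 v : G, (x \in black G) = (y \in black G) ->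
    adj x u1 -> adj x u2 -> u1 != u2 -> ~~ adj y u1 -> ~~ adj y u2 ->
    adj y v -> adj x v.
Proof.
pose H := disjoint_union (path_graph 2) (path_graph 3).
pose h0 : H := inl ord0; pose h1 : H := inl ord_max.
pose h2 : H := inr ord0; pose h3 : H := inr (@Ordinal 3 1 isT).
pose h4 : H := inr ord_max.
split=> [Gfree x y u1 u2 v xy xu1 xu2 u12 yu1 yu2 yv | Gcond].
  apply/negPn/negP => xv; apply/Gfree/contains_inducedP.
  pose g (h : H) : G := match h with
    | inl i => if val i is 0 then y else v
    | inr i => match val i with 0 => u1 | 1 => x | _ => u2 end
    end.
  have gadj a b : adj (g a) (g b) = adj a b.
    have xyF := same_part_nadj xy.
    have u12F : adj u1 u2 = false.
      by apply/same_part_nadj/negb_inj; rewrite -(adj_black xu1) -(adj_black xu2).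
    have vF u : adj x u -> adj v u = false.
      move=> xu; apply/same_part_nadj/negb_inj.
      by rewrite -(adj_black yv) -(adj_black xu).
    have adjE := (xu1, xu2, yv, xyF, u12F, vF _ xu1, vF _ xu2,
                  negPf yu1, negPf yu2, negPf xv, adj_irrefl).
    case: a b => [[[|[|//]] ?]|[[|[|[|//]]] ?]] [[[|[|//]] ?]|[[|[|[|//]]] ?]];
      by rewrite /= ?adjE // adj_sym ?adjE.
  (* Vertices with the same image are twins, and the only distinct twins of P2 + P3 are the ends of
     the P3, which [u12] separates. *)
  exists g => // a b gab.
  have tw c : adj a c = adj b c by rewrite -!gadj gab.
  have := (tw h0, tw h1, tw h2, tw h3, tw h4).
  have := gab; case: a b {gab tw} => [[[|[|//]] ?]|[[|[|[|//]]] ?]]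
    [[[|[|//]] ?]|[[|[|[|//]]] ?]] /= gab; rewrite /path_adj //= => -[[[[]]]] //;
    by [move=> *; congr (_ _); apply: val_inj | rewrite gab eqxx in u12].
case/contains_inducedP => g g_inj gadj.
have nadj a b : ~~ adj a b -> ~~ adj (g a) (g b) by rewrite gadj.
(* With [a] each end of the P2 in turn, the centre [h3] of the P3 would lie in the part opposite to
   both, yet adjacent ends lie in different parts. *)
have key a b : adj a b -> ~~ adj h3 b -> ~~ adj a h2 -> ~~ adj a h4 ->
    (g h3 \in black G) != (g a \in black G).
  move=> ab n3 n2 n4; apply/eqP => sp.
  have := @Gcond (g h3) (g a) (g h2) (g h4) (g b) sp.
  rewrite (inj_eq g_inj) !gadj ab (negPf n3) (negPf n2) (negPf n4).
  by move=> /(_ isT isT isT isT isT isT).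
have := @adj_black G (g h0) (g h1); rewrite gadj => /(_ isT).
move: (key h0 h1 isT isT isT isT) (key h1 h0 isT isT isT isT).
by do 3!case: (_ \in _).
Qed.

(** An embedded biclique may have its first side in either part; the vertex [i0], available since
    [p] is positive, tells which, and the sides are exchanged if necessary. *)
Lemma bicliqueP (G : bigraph) p : 0 < p ->
  contains_induced G (biclique p p) <->
  exists S T : {set G}, [/\ S \subset black G, T \subset white G, p <= #|S|,
    p <= #|T| & {in S & T, forall x y, adj x y}].
Proof.
move=> p_gt0; split=> [/contains_inducedP [g g_inj gadj] | ].
  pose i0 := Ordinal p_gt0.
  have lr i j : (g (inl i) \in black G) = (g (inr j) \notin black G).
    by apply: adj_black; rewrite gadj.
  have l0 i : (g (inl i) \in black G) = (g (inl i0) \in black G).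
    by rewrite !(lr _ i0).
  have r0 i : (g (inr i) \in black G) = (g (inl i0) \notin black G).
    by rewrite (lr i0 i) negbK.
  have cardl : p <= #|[set g (inl i) | i : 'I_p]|.
    by rewrite card_imset ?card_ord // => i j /g_inj [].
  have cardr : p <= #|[set g (inr i) | i : 'I_p]|.
    by rewrite card_imset ?card_ord // => i j /g_inj [].
  case b0: (g (inl i0) \in black G).
    exists [set g (inl i) | i : 'I_p], [set g (inr i) | i : 'I_p]; split=> //.
    - by apply/subsetP => _ /imsetP [i _ ->]; rewrite l0.
    - by apply/subsetP => _ /imsetP [i _ ->]; rewrite white_notin_black r0 b0.
    - by move=> _ _ /imsetP [i _ ->] /imsetP [j _ ->]; rewrite gadj.
  exists [set g (inr i) | i : 'I_p], [set g (inl i) | i : 'I_p]; split=> //.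
  - by apply/subsetP => _ /imsetP [i _ ->]; rewrite r0 b0.
  - by apply/subsetP => _ /imsetP [i _ ->]; rewrite white_notin_black l0 b0.
  - by move=> _ _ /imsetP [i _ ->] /imsetP [j _ ->]; rewrite gadj.
case=> S [T [SB TW pS pT ST]]; apply/contains_inducedP.
pose l (i : 'I_p) := enum_val (widen_ord pS i).
pose r (i : 'I_p) := enum_val (widen_ord pT i).
have lS i : l i \in S by apply: enum_valP.
have rT i : r i \in T by apply: enum_valP.
have lB i : l i \in black G by apply: (subsetP SB).
have rB i : r i \in black G = false.
  by apply/negbTE; rewrite -white_notin_black (subsetP TW).
exists (fun z => match z with inl i => l i | inr j => r j end).
  have widen_inj m n (mn : m <= n) : injective (widen_ord mn).
    by move=> i j /(congr1 val) ij; apply: val_inj.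
  case=> i [] j.
  - by move=> /enum_val_inj /widen_inj ->.
  - by move=> lr; have := lB i; rewrite lr rB.
  - by move=> rl; have := lB j; rewrite -rl rB.
  - by move=> /enum_val_inj /widen_inj ->.
case=> i [] j /=.
- by apply: same_part_nadj; rewrite !lB.
- exact: ST.
- by rewrite adj_sym ST.
- by apply: same_part_nadj; rewrite !rB.
Qed.

(** * Cardinalities and neighbourhood systems *)

Lemma subset_of_card (X : finType) (S : {set X}) n :
  n <= #|S| -> exists2 S' : {set X}, S' \subset S & #|S'| = n.
Proof.
case/card_geqP => s [s_uniq <- sS]; exists [set x in s].
  by apply/subsetP => x; rewrite inE; apply: sS.
by rewrite cardsE; apply/card_uniqP.
Qed.

Lemma cardsU_disjoint (X : finType) (A B : {set X}) :
  [disjoint A & B] -> #|A :|: B| = #|A| + #|B|.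
Proof. by rewrite cardsU => /disjoint_setI0 ->; rewrite cards0 subn0. Qed.

Definition transpose (X Y : finType) (N : X -> {set Y}) : Y -> {set X} :=
  fun y => [set x | y \in N x].

Definition compl (X Y : finType) (N : X -> {set Y}) : X -> {set Y} :=
  fun x => ~: N x.

(* For a vertex x of one part with neighbourhood N x in the other, this forbids
   the induced P2 + P3 whose P3 has its centre in the part X. *)
Definition swap_free (X Y : finType) (N : X -> {set Y}) :=
  forall x y, 1 < #|N x :\: N y| -> N y \subset N x.

Definition biclique_free (X Y : finType) (N : X -> {set Y}) p :=
  forall (S : {set X}) (T : {set Y}),
    {in S, forall x, T \subset N x} -> p <= #|S| -> #|T| < p.

(** * Levels of equal degree and the upper bound *)

Section NeighbourhoodSystems.
Variables X Y : finType.
Implicit Types (N : X -> {set Y}) (L S : {set X}) (T U K : {set Y}).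

(** Fix two members [N x], [N y], which differ by exchanging [s] and [t]. Either every member
    contains their intersection, or some member misses a point of it, and this confines all members
    to their union. *)
Lemma uniform_classification N L d :
    {in L, forall z, #|N z| = d} ->
    {in L &, forall z w, #|N z :\: N w| <= 1} ->
    {in L &, injective N} ->
    1 < #|L| ->
  (exists K, exists f : X -> Y,
     {in L, forall z, f z \notin K /\ N z = f z |: K}) \/
  (exists U, exists f : X -> Y,
     {in L, forall z, f z \in U /\ N z = U :\ f z}).
Proof.
move=> Nd N1 N_inj /card_gt1P [x [y [xL yL xy]]].
have le1 z w a b : z \in L -> w \in L -> a \in N z -> a \notin N w ->
    b \in N z -> b \notin N w -> a = b.
  move=> zL wL az aw bz bw.
  by apply: (card_le1_eqP (N1 z w zL wL)); rewrite in_setD ?aw ?bw.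
have diff z w : z \in L -> w \in L -> z != w ->
    exists a, N z :\: N w = [set a].
  move=> zL wL zw; apply/cards1P; rewrite eqn_leq N1 //= card_gt0 setD_eq0.
  apply: contraNN zw => Nzw; apply/eqP/N_inj => //; apply/eqP.
  by rewrite eqEcard Nzw !Nd /=.
have [s Ds] := diff x y xL yL xy.
have [t Dt] : exists a, N y :\: N x = [set a] by apply: diff; rewrite // eq_sym.
have : s \in N x :\: N y by rewrite Ds set11.
have : t \in N y :\: N x by rewrite Dt set11.
rewrite !in_setD => /andP [tx ty] /andP [sy sx].
have cK : #|N x :&: N y|.+1 = d.
  by rewrite -(Nd x xL) -(cardsID (N y) (N x)) Ds cards1 addn1.
have cU : #|N x :|: N y| = d.+1.
  by have := cardsUI (N x) (N y); rewrite !Nd //; lia.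
case: (boolP [forall z in L, N x :&: N y \subset N z]) => [/forall_inP KN | ].
  left; exists (N x :&: N y).
  suff /fin_all_exists [f fP] : forall z, exists a, z \in L ->
      a \notin N x :&: N y /\ N z = a |: (N x :&: N y).
    by exists f => z /fP.
  (* Outside [L] the value of [f] is arbitrary; [s] is the default. *)
  move=> z; case: (boolP (z \in L)) => [zL | _]; last by exists s.
  have /eqP/cards1P [a Da] : #|N z :\: (N x :&: N y)| = 1.
    by rewrite cardsDS ?KN // Nd // -cK subSnn.
  have : a \in N z :\: (N x :&: N y) by rewrite Da set11.
  rewrite in_setD => /andP [aK az]; exists a => _; split=> //.
  by rewrite -Da -{1}(setID (N z) (N x :&: N y)) (setIidPr _) ?KN // setUC.
case/forall_inPn => z0 z0L /subsetPn [v /setIP [vx vy] vz].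
have sz : s \in N z0.
  by apply: contraNT sy => sz; rewrite (le1 x z0 s v).
have tz : t \in N z0.
  by apply: contraNT tx => tz; rewrite (le1 y z0 t v).
(* A point [u] of [N w] outside the union keeps both [s] and [t] out of [N w]; then [N z0], which
   contains both, would exceed [N w] by two points. *)
have NU w : w \in L -> N w \subset N x :|: N y.
  move=> wL; apply/subsetP => u uw; apply/negPn/negP.
  rewrite in_setU negb_or => /andP [ux uy].
  have sw : s \notin N w.
    by apply: contraNN ux => sw; rewrite -(le1 w y s u).
  have tw : t \notin N w.
    by apply: contraNN uy => tw; rewrite -(le1 w x t u).
  by move: tx; rewrite -(le1 z0 w s t) // sx.
right; exists (N x :|: N y).
suff /fin_all_exists [f fP] : forall z, exists a, z \in L ->
    a \in N x :|: N y /\ N z = (N x :|: N y) :\ a.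
  by exists f => z /fP.
move=> z; case: (boolP (z \in L)) => [zL | _]; last by exists s.
have /eqP/cards1P [a Da] : #|(N x :|: N y) :\: N z| = 1.
  by rewrite cardsDS ?NU // Nd // cU subSnn.
have : a \in (N x :|: N y) :\: N z by rewrite Da set11.
rewrite in_setD => /andP [_ aU]; exists a => _; split=> //.
by rewrite -Da setDDr setDv set0U (setIidPr _) ?NU.
Qed.

Lemma matching_level_bound N p q (Lo L Hi : {set X}) K (f : X -> Y) :
    biclique_free N p -> biclique_free (compl N) q ->
    #|Lo| < q -> #|Hi| < p -> q <= #|Lo| + #|L| -> p <= #|L| + #|Hi| ->
    [disjoint Lo & L] -> [disjoint L & Hi] ->
    {in Lo & L, forall x z, N x \subset N z} ->
    {in L & Hi, forall z x, N z \subset N x} ->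
    {in L &, injective N} ->
    {in L, forall z, f z \notin K /\ N z = f z |: K} ->
    maxn p q + p + q - 2 <= #|Lo| + #|L| + #|Hi| ->
    #|Y| < maxn p q + p + q - 2.
Proof.
move=> Np Nq Loq Hip LoL LHi dLo dHi LoN HiN N_inj NE cX.
have f_inj : {in L &, injective f}.
  move=> z w zL wL fzw; apply: N_inj => //.
  by rewrite (NE z zL).2 (NE w wL).2 fzw.
have cKf L' : L' \subset L -> #|K :|: f @: L'| = #|K| + #|L'|.
  move=> /subsetP L'L; rewrite cardsU card_in_imset => [|z w /L'L zL /L'L wL];
    last exact: f_inj.
  rewrite disjoint_setI0 ?cards0 ?subn0 // disjoint_sym.
  apply/pred0P => y /=; apply/negP => /andP [/imsetP [z /L'L zL ->]].
  by rewrite (negPf (NE z zL).1).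
have cY : #|K| + #|L| <= #|Y| by rewrite -cKf // max_card.
have [L1 L1L cL1] : exists2 S : {set X}, S \subset L & #|S| = q - #|Lo|.
  by apply: subset_of_card; lia.
have [L2 L2L cL2] : exists2 S : {set X}, S \subset L & #|S| = p - #|Hi|.
  by apply: subset_of_card; lia.
(* The [q] lowest vertices [Lo :|: L1] have all their neighbours in [K :|: f @: L1], so fewer than
   [q] points lie outside that set. *)
have bottom : #|Y| < #|K| + (q - #|Lo|) + q.
  have := Nq (Lo :|: L1) (~: (K :|: f @: L1)).
  rewrite cardsU_disjoint ?(disjointWr L1L) // cL1.
  rewrite [#|~: _|]cardsCs setCK cKf // cL1 => bottom.
  have /bottom : {in Lo :|: L1, forall x, ~: (K :|: f @: L1) \subset compl N x}.
    have sub z : z \in L1 -> N z \subset K :|: f @: L1.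
      move=> zL1; rewrite (NE z (subsetP L1L z zL1)).2 setUC setUS //.
      by rewrite sub1set imset_f.
    move=> x; rewrite /compl setCS => /setUP [xLo | /sub //].
    (* As [#|Lo| < q], some [z] in [L1] lies above all of [Lo]. *)
    have /card_gt0P [z zL1] : 0 < #|L1| by lia.
    by apply: subset_trans (sub z zL1); apply: LoN (subsetP L1L z zL1).
  by lia.
have KN x : x \in Hi :|: L2 -> K \subset N x.
  have sub z : z \in L2 -> K \subset N z.
    by move=> zL2; rewrite (NE z (subsetP L2L z zL2)).2 subsetUr.
  case/setUP => [xHi | /sub //].
  have /card_gt0P [z zL2] : 0 < #|L2| by lia.
  by apply: subset_trans (sub z zL2) _; apply: HiN (subsetP L2L z zL2) _.
have cHi2 : #|Hi :|: L2| = p.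
  rewrite cardsU_disjoint ?cL2; first by lia.
  by rewrite disjoint_sym (disjointWl L2L).
have top : #|K| < p by apply: Np KN _; rewrite cHi2.
(* This settles the tight case [p <= q], [Lo] empty, [#|K| = p - 1], where [cY] and [cX] force
   [#|Hi| = p - 1]: the single vertex of [L2] adds its own [f z] to the common neighbours. *)
have top1 : #|Hi|.+1 = p -> #|K|.+1 < p.
  move=> Hi1; have /eqP/cards1P [z Ez] : #|L2| = 1 by lia.
  have zL : z \in L by apply: (subsetP L2L); rewrite Ez set11.
  have [fK Nz] := NE z zL.
  have -> : #|K|.+1 = #|N z| by rewrite Nz cardsU1 fK.
  apply: (Np (Hi :|: L2)) => [x|]; last by rewrite cHi2.
  by case/setUP => [/(HiN z x zL) // |]; rewrite Ez => /set1P ->.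
by lia.
Qed.

(** Double complementation gives back [N] only pointwise, so the property is carried over by
    hand. *)
Lemma biclique_free_compl2 N p :
  biclique_free N p -> biclique_free (compl (compl N)) p.
Proof.
by move=> Np S T ST; apply: Np => x /ST; rewrite /compl setCK.
Qed.

(** Complementing turns [N x :\: N y] into [N y :\: N x], so [x] and [y] exchange roles. *)
Lemma swap_free_compl N : swap_free N -> swap_free (compl N).
Proof.
move=> Nsf x y; rewrite /compl setCS => xy; apply: Nsf.
by rewrite setDE setIC -[N y]setCK -setDE.
Qed.

(** If [N x] has a point outside [N y], the larger [N y] has two outside [N x], and the exchange
    condition gives the inclusion after all. *)
Lemma swap_free_subset N x y :
  swap_free N -> #|N x| < #|N y| -> N x \subset N y.
Proof.
move=> Nsf xy; apply/negPn/negP => nxy.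
have : N x :\: N y != set0 by rewrite setD_eq0.
rewrite -card_gt0 => D0; move/negP: nxy; apply; apply: Nsf.
by have := cardsID (N y) (N x); have := cardsID (N x) (N y); rewrite setIC; lia.
Qed.

Lemma swap_free_swap N x y :
  swap_free N -> #|N x| = #|N y| -> #|N x :\: N y| <= 1.
Proof.
move=> Nsf xy; rewrite leqNgt; apply/negP => D1.
have /setIidPr Ixy := Nsf x y D1.
by have := cardsID (N y) (N x); rewrite Ixy; lia.
Qed.

(** Twins [z], [w] and a vertex [u] of the same degree with another neighbourhood would give a P3
    [z s w] and a P2 [u t], with the centre [s] in the other part. *)
Lemma swap_free_twins N L d :
    swap_free (transpose N) -> {in L, forall z, #|N z| = d} ->
    ~~ [forall z in L, forall w in L, N z == N w] ->
  {in L &, injective N}.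
Proof.
move=> Tsf Nd /forall_inPn [x xL /forall_inPn [y yL Nxy]] z w zL wL Nzw.
apply/eqP/negPn/negP => zw.
have [u uL Nzu] : exists2 u, u \in L & N z != N u.
  by case: (eqVneq (N z) (N x)) => [E | ]; [exists y; rewrite ?E | exists x].
have [s sz su] : exists2 s, s \in N z & s \notin N u.
  by apply/subsetPn; apply: contraNN Nzu => zu; rewrite eqEcard zu !Nd /=.
have [t tu tz] : exists2 t, t \in N u & t \notin N z.
  apply/subsetPn; apply: contraNN Nzu => uz.
  by rewrite eq_sym eqEcard uz !Nd /=.
have /subsetP /(_ u) : transpose N t \subset transpose N s.
  apply: Tsf; apply/card_gt1P; exists z, w.
  by rewrite !inE -Nzw sz tz.
by rewrite !inE (negPf su) => /(_ tu).
Qed.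

Lemma bipartite_Ramsey_upper N p q :
    0 < p -> 0 < q -> swap_free N -> swap_free (transpose N) ->
    biclique_free N p -> biclique_free (compl N) q ->
    maxn p q + p + q - 2 <= #|X| ->
    #|Y| < maxn p q + p + q - 2.
Proof.
move=> p0 q0 Nsf Tsf Np Nq cX.
have exd : exists d, q <= #|[set x | #|N x| <= d]|.
  exists #|Y|; have -> : [set x | #|N x| <= #|Y|] = setT.
    by apply/setP => x; rewrite !inE max_card.
  by rewrite cardsT; lia.
(* Minimality of [d] is what makes [Lo] smaller than [q]. *)
case: (ex_minnP exd) => d qd dmin.
pose Lo := [set x | #|N x| < d]; pose L := [set x | #|N x| == d].
pose Hi := [set x | d < #|N x|].
have LoLE : [set x | #|N x| <= d] = Lo :|: L.
  by apply/setP => x; rewrite !inE leq_eqVlt orbC.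
have dLo : [disjoint Lo & L].
  by apply/pred0P => x; rewrite /= !inE; case: ltngtP.
have dHi : [disjoint L & Hi].
  by apply/pred0P => x; rewrite /= !inE; case: ltngtP.
have LHiE : ~: Lo = L :|: Hi.
  by apply/setP => x; rewrite !inE; case: ltngtP.
have cXE : #|Lo| + #|L| + #|Hi| = #|X|.
  by rewrite -(cardsC Lo) LHiE (cardsU_disjoint dHi) addnA.
have LoLq : q <= #|Lo| + #|L| by rewrite -cardsU_disjoint // -LoLE.
have Loq : #|Lo| < q.
  rewrite ltnNge; apply/negP => qLo.
  case: d {exd qd L Hi LoLE dLo dHi LHiE cXE LoLq} @Lo qLo dmin => [|d] Lo qLo dmin.
    suff Lo0 : Lo = set0 by rewrite Lo0 cards0 leqn0 in qLo; rewrite (eqP qLo) in q0.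
    by apply/setP => x; rewrite !inE ltn0.
  by have := dmin d qLo; rewrite ltnn.
have LoN : {in Lo & L, forall x z, N x \subset N z}.
  by move=> x z; rewrite !inE => xd /eqP zd; apply: swap_free_subset; rewrite ?zd.
have HiN : {in L & Hi, forall z x, N z \subset N x}.
  by move=> z x; rewrite !inE => /eqP zd xd; apply: swap_free_subset; rewrite ?zd.
rewrite ltnNge; apply/negP => cY.
have Hip : #|Hi| < p.
  rewrite ltnNge; apply/negP => pHi.
  (* [U] lies in every neighbourhood from [Hi] and its complement is missed by all of [Lo :|: L], so
     [#|Y| <= p + q - 2]. *)
  pose U := \bigcup_(x in Lo :|: L) N x.
  have : #|U| < p.
    apply: (Np Hi) pHi => x xHi; apply/bigcupsP => y yLoL.
    apply: swap_free_subset => //; move: yLoL xHi; rewrite -LoLE !inE.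
    exact: leq_ltn_trans.
  have : #|~: U| < q.
    apply: (Nq (Lo :|: L)); last by rewrite cardsU_disjoint.
    by move=> x xL; rewrite setCS (bigcup_sup x).
  by have := cardsC U; lia.
have LHip : p <= #|L| + #|Hi| by lia.
have Nd : {in L, forall z, #|N z| = d} by move=> z; rewrite inE => /eqP.
have N1 : {in L &, forall z w, #|N z :\: N w| <= 1}.
  by move=> z w zL wL; apply: swap_free_swap; rewrite ?Nd.
case: (boolP [forall z in L, forall w in L, N z == N w]) => [twins | ntwins].
  (* The common neighbourhood [N z] of the level plays the part that [U] played above. *)
  have /card_gt0P [z zL] : 0 < #|L| by lia.
  have Nz w : w \in L -> N w = N z.
    by move=> wL; apply/eqP; move/forall_inP: twins => /(_ w wL) /forall_inP ->.
  have : #|N z| < p.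
    apply: (Np (L :|: Hi)); last by rewrite cardsU_disjoint.
    by move=> x /setUP [/Nz -> // | /(HiN z x zL)].
  have : #|~: N z| < q.
    apply: (Nq (Lo :|: L)); last by rewrite cardsU_disjoint.
    by move=> x; rewrite setCS => /setUP [/LoN -> // | /Nz ->].
  by have := cardsC (N z); lia.
have N_inj := swap_free_twins Tsf Nd ntwins.
have L1 : 1 < #|L|.
  case/forall_inPn: ntwins => x xL /forall_inPn [y yL Nxy].
  by apply/card_gt1P; exists x, y; split=> //; apply: contraNneq Nxy => ->.
case: (uniform_classification Nd N1 N_inj L1) => [[K [f NE]] | [U [f NE]]].
  have := matching_level_bound Np Nq Loq Hip LoLq LHip dLo dHi LoN HiN N_inj NE.
  by lia.
(* In the complement the level has the form [~: U] plus one point [f z], while [p] and [q], and also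
   [Lo] and [Hi], trade places. *)
have := @matching_level_bound (compl N) q p Hi L Lo (~: U) f Nq.
move/(_ (biclique_free_compl2 Np) Hip Loq).
rewrite disjoint_sym dHi disjoint_sym dLo (maxnC q p) => bound.
suff : #|Y| < maxn p q + q + p - 2 by lia.
apply: bound => //; try lia.
- by move=> x z xHi zL; rewrite setCS HiN.
- by move=> z x zL xLo; rewrite setCS LoN.
- by move=> z w zL wL /setC_inj; apply: N_inj.
- by move=> z /NE [fU Nz]; rewrite /compl Nz inE fU setCD setUC.
Qed.

End NeighbourhoodSystems.

(** * From bipartite graphs to neighbourhood systems *)

Section BlackNeighbourhoods.
Variable G : bigraph.

Definition black_nbr (x : {x | x \in black G}) : {set {y | y \in white G}} :=
  [set y | adj (val x) (val y)].

(** The two conclusions correspond to the part that contains the centre of the P3. *)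
Lemma black_nbr_swap_free : P2P3_free_bipartite G ->
  swap_free black_nbr /\ swap_free (transpose black_nbr).
Proof.
move/P2P3_freeP => Gfree; split=> x y /card_gt1P [u1 [u2 []]]; rewrite !inE.
  move=> /andP [yu1 xu1] /andP [yu2 xu2] u12; apply/subsetP => v; rewrite !inE.
  by apply: (Gfree _ _ (val u1) (val u2)); rewrite ?(valP x) ?(valP y).
move=> /andP [yu1 xu1] /andP [yu2 xu2] u12; apply/subsetP => v; rewrite !inE.
rewrite ![adj (val v) _]adj_sym.
move: xu1 yu1 xu2 yu2; rewrite ![adj (val _) (val x)]adj_sym.
rewrite ![adj (val _) (val y)]adj_sym => xu1 yu1 xu2 yu2.
apply: (Gfree _ _ (val u1) (val u2)) => //.
have /negPf -> : val x \notin black G by rewrite -white_notin_black (valP x).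
by apply/esym/negbTE; rewrite -white_notin_black (valP y).
Qed.

Lemma black_nbr_biclique_free p : 0 < p ->
  ~ contains_induced G (biclique p p) -> biclique_free black_nbr p.
Proof.
move=> p0 Gp S T ST pS; rewrite ltnNge; apply/negP => pT; apply: Gp.
apply/bicliqueP => //; exists (val @: S), (val @: T); split.
- by apply/subsetP => _ /imsetP [x _ ->]; apply: valP.
- by apply/subsetP => _ /imsetP [x _ ->]; apply: valP.
- by rewrite card_imset //; apply: val_inj.
- by rewrite card_imset //; apply: val_inj.
- move=> _ _ /imsetP [x xS ->] /imsetP [y yT ->].
  by have := subsetP (ST x xS) y yT; rewrite inE.
Qed.

Lemma black_nbr_compl_biclique_free q : 0 < q ->
  ~ contains_induced (bicompl G) (biclique q q) ->
  biclique_free (compl black_nbr) q.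
Proof.
move=> q0 Gq S T ST qS; rewrite ltnNge; apply/negP => qT; apply: Gq.
apply/bicliqueP => //; exists (val @: S), (val @: T); split.
- by apply/subsetP => _ /imsetP [x _ ->]; apply: valP.
- by apply/subsetP => _ /imsetP [x _ ->]; apply: valP.
- by rewrite card_imset //; apply: val_inj.
- by rewrite card_imset //; apply: val_inj.
- move=> _ _ /imsetP [x xS ->] /imsetP [y yT ->]; rewrite /= /bicompl_adj.
  by have := subsetP (ST x xS) y yT; rewrite !inE (valP x) (valP y).
Qed.

End BlackNeighbourhoods.

(** * From neighbourhood systems to bipartite graphs *)

Section BigraphOfNeighbourhoods.
Variables (X Y : finType) (N : X -> {set Y}).

Definition nbr_adj : rel (X + Y)%type := fun u v =>
  match u, v with
  | inl x, inr y | inr y, inl x => y \in N x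
  | _, _ => false
  end.

Lemma nbr_adj_sym : symmetric nbr_adj. Proof. by case=> x []. Qed.
Lemma nbr_adj_irrefl : irreflexive nbr_adj. Proof. by case. Qed.

Definition nbr_graph := SGraph nbr_adj_sym nbr_adj_irrefl.

Definition nbr_black : {set nbr_graph} := [set inl x | x : X].
Definition nbr_white : {set nbr_graph} := [set inr y | y : Y].

Lemma inl_black x : (inl x \in nbr_black) = true.
Proof. exact: imset_f. Qed.

Lemma inr_black y : (inr y \in nbr_black) = false.
Proof. by apply/imsetP => -[]. Qed.

Lemma inl_white x : (inl x \in nbr_white) = false.
Proof. by apply/imsetP => -[]. Qed.

Lemma inr_white y : (inr y \in nbr_white) = true.
Proof. exact: imset_f. Qed.

Let nbrE := (inl_black, inr_black, inl_white, inr_white).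

Lemma nbr_cover : nbr_black :|: nbr_white = setT.
Proof. by apply/setP => -[] z; rewrite !inE !nbrE. Qed.

Lemma nbr_disjoint : [disjoint nbr_black & nbr_white].
Proof. by apply/pred0P => -[] z; rewrite /= !nbrE. Qed.

Lemma nbr_black_independent : independent nbr_black.
Proof. by case=> x [] y; rewrite !nbrE. Qed.

Lemma nbr_white_independent : independent nbr_white.
Proof. by case=> x [] y; rewrite !nbrE. Qed.

Definition bigraph_of_nbr : bigraph :=
  BiGraph nbr_cover nbr_disjoint nbr_black_independent nbr_white_independent.

Lemma card_bigraph_of_nbr :
  #|black bigraph_of_nbr| = #|X| /\ #|white bigraph_of_nbr| = #|Y|.
Proof. by split; rewrite card_imset // => x y []. Qed.

Lemma bigraph_of_nbr_free : swap_free N -> swap_free (transpose N) ->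
  P2P3_free_bipartite bigraph_of_nbr.
Proof.
move=> Nsf Tsf; apply/P2P3_freeP => -[x|x] [y|y] u1 u2 v; rewrite /= !nbrE // => _.
  case: u1 u2 v => [//|u1] [//|u2] [//|v] xu1 xu2 u12 yu1 yu2 yv.
  apply: (subsetP (Nsf x y _)) yv; apply/card_gt1P; exists u1, u2.
  by rewrite !inE yu1 yu2 xu1 xu2.
case: u1 u2 v => [u1|//] [u2|//] [v|//] xu1 xu2 u12 yu1 yu2 yv.
have /subsetP /(_ v) : transpose N y \subset transpose N x.
  by apply: Tsf; apply/card_gt1P; exists u1, u2; rewrite !inE yu1 yu2 xu1 xu2.
by rewrite !inE; apply.
Qed.

(** Adjacency is left out so that the graph and its bipartite complement can both use this. *)
Lemma nbr_biclique_split p (S T : {set bigraph_of_nbr}) :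
    S \subset nbr_black -> T \subset nbr_white -> p <= #|S| -> p <= #|T| ->
  exists (S' : {set X}) (T' : {set Y}), [/\ p <= #|S'|, p <= #|T'|,
    {in S', forall x, inl x \in S} & {in T', forall y, inr y \in T}].
Proof.
move=> SB TW pS pT; exists [set x | inl x \in S], [set y | inr y \in T].
split; try by move=> z; rewrite inE.
  rewrite -(card_imset _ (inl_inj (B := Y))); apply: leq_trans pS (subset_leq_card _).
  apply/subsetP => z zS; have /imsetP [x _ zx] := subsetP SB z zS.
  by rewrite zx imset_f // inE -zx.
rewrite -(card_imset _ (inr_inj (A := X))); apply: leq_trans pT (subset_leq_card _).
apply/subsetP => z zT; have /imsetP [x _ zx] := subsetP TW z zT.
by rewrite zx imset_f // inE -zx.
Qed.

Lemma bigraph_of_nbr_biclique p : 0 < p -> biclique_free N p ->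
  ~ contains_induced bigraph_of_nbr (biclique p p).
Proof.
move=> p0 Np /(bicliqueP _ p0) [S [T [SB TW pS pT ST]]].
have [S' [T' [pS' pT' SS TT]]] := nbr_biclique_split SB TW pS pT.
have := Np S' T' _ pS'; rewrite ltnNge pT' => /(_ _)/negP; apply=> // x xS.
by apply/subsetP => y yT; apply: (ST (inl x) (inr y)); [apply: SS | apply: TT].
Qed.

Lemma bigraph_of_nbr_compl_biclique q : 0 < q -> biclique_free (compl N) q ->
  ~ contains_induced (bicompl bigraph_of_nbr) (biclique q q).
Proof.
move=> q0 Nq /(bicliqueP _ q0) [S [T [SB TW qS qT ST]]].
have [S' [T' [qS' qT' SS TT]]] := nbr_biclique_split SB TW qS qT.
have := Nq S' T' _ qS'; rewrite ltnNge qT' => /(_ _)/negP; apply=> // x xS.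
apply/subsetP => y yT; rewrite inE.
by have /andP [] := ST (inl x) (inr y) (SS x xS) (TT y yT).
Qed.

End BigraphOfNeighbourhoods.

(** * The extremal graphs *)

(* A perfect matching on the indices k, ..., m - 1, with the first k vertices of
   each part adjacent to the whole other part. *)
Definition matching_nbr k m (i : 'I_m) : {set 'I_m} :=
  [set j : 'I_m | (i < k) || (j < k) || (i == j)].

(** Points outside a neighbourhood have index at least [k], and a matched vertex has only one such
    neighbour. Two of them force [i < k], where the neighbourhood is everything. *)
Lemma matching_nbr_swap_free k m : swap_free (@matching_nbr k m).
Proof.
move=> i j /card_gt1P [u1 [u2 []]]; rewrite !inE !negb_or -!andbA.
move=> /and4P [jk u1k _ iu1] /and4P [_ u2k _ iu2] u12; apply/subsetP => v _.
move: iu1 iu2; rewrite inE (negPf u1k) (negPf u2k) !orbF.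
by case: (i < k) => //= /eqP iu1 /eqP iu2; rewrite -iu1 iu2 eqxx in u12.
Qed.

Lemma matching_nbr_transpose k m i :
  transpose (@matching_nbr k m) i = matching_nbr k i.
Proof.
by apply/setP => j; rewrite !inE eq_sym [(j < k) || _]orbC.
Qed.

Lemma card_ord_ltn k m : #|[set i : 'I_m | i < k]| <= k.
Proof.
rewrite cardsE cardE -(size_map val) -[k in _ <= k](size_iota 0).
apply: uniq_leq_size.
  by rewrite (map_inj_uniq val_inj) enum_uniq.
by move=> _ /mapP [i + ->]; rewrite mem_enum mem_iota.
Qed.

Lemma card_gt_ord k m (S : {set 'I_m}) : k.+2 <= #|S| ->
  exists i j, [/\ i \in S, j \in S, i != j, k <= i & k <= j].
Proof.
move=> kS; have : 1 < #|S :\: [set i : 'I_m | i < k]|.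
  rewrite -(ltn_add2l #|S :&: [set i : 'I_m | i < k]|) cardsID addn1.
  apply: leq_trans kS; rewrite !ltnS; apply: leq_trans (card_ord_ltn k m).
  by rewrite subset_leq_card ?subsetIr.
case/card_gt1P => i [j []]; rewrite !inE -!leqNgt.
by move=> /andP [ki iS] /andP [kj jS] ij; exists i, j.
Qed.

(** Otherwise some matched vertex would have two matched neighbours. *)
Lemma matching_nbr_biclique_free k m : biclique_free (@matching_nbr k m) k.+2.
Proof.
move=> S T ST kS; rewrite ltnNge; apply/negP => kT.
have [i [_ [iS _ _ ki _]]] := card_gt_ord kS.
have [j1 [j2 [j1T j2T j12 kj1 kj2]]] := card_gt_ord kT.
have iE (j : 'I_m) : j \in T -> k <= j -> i = j.
  move=> jT kj; have := subsetP (ST i iS) j jT.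
  by rewrite inE !ltnNge ki kj => /eqP.
by rewrite -(iE j1) // (iE j2) // eqxx in j12.
Qed.

(** The two sides would be disjoint sets of indices among the [m - k] matched ones, which are fewer
    than [2 * q]. *)
Lemma matching_nbr_compl_biclique_free k m q : m < k + 2 * q -> 0 < q ->
  biclique_free (compl (@matching_nbr k m)) q.
Proof.
move=> mq q0 S T ST qS; rewrite ltnNge; apply/negP => qT.
have far i j : i \in S -> j \in T -> [/\ k <= i, k <= j & i != j].
  move=> iS jT; have := subsetP (ST i iS) j jT.
  by rewrite !inE !negb_or -!leqNgt -andbA => /and3P.
(* One element on each side lets [far] apply to every element of the other. *)
have /card_gt0P [i0 i0S] : 0 < #|S| by lia.
have /card_gt0P [j0 j0T] : 0 < #|T| by lia.
have dST : [disjoint S & T].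
  apply/pred0P => i; apply/negP => /andP [iS iT].
  by have [_ _] := far i i iS iT; rewrite eqxx.
have low : k <= #|[set i : 'I_m | i < k]|.
  have km : k <= m by have [+ _ _] := far _ _ i0S j0T; have := ltn_ord i0; lia.
  have kE : #|[set widen_ord km i | i : 'I_k]| = k.
    by rewrite card_imset ?card_ord // => i j /(congr1 val) ij; apply: val_inj.
  rewrite -{1}kE; apply/subset_leq_card/subsetP => _ /imsetP [i _ ->].
  by rewrite inE; apply: (valP i).
have sub : S :|: T \subset ~: [set i : 'I_m | i < k].
  apply/subsetP => i; rewrite !inE -leqNgt => /orP [iS | iT].
    by have [] := far _ _ iS j0T.
  by have [] := far _ _ i0S iT.
have := subset_leq_card sub; rewrite cardsU_disjoint //.
rewrite -(leq_add2l #|[set i : 'I_m | i < k]|) cardsC card_ord.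
by move/(leq_trans (leq_add low (leq_add qS qT))); lia.
Qed.

(** * The lower bound and the exact value *)

Lemma bipartite_Ramsey_lower (X Y : finType) (N : X -> {set Y}) p q m :
    0 < p -> 0 < q -> swap_free N -> swap_free (transpose N) ->
    biclique_free N p -> biclique_free (compl N) q ->
    bipartite_Ramsey_bound P2P3_free_bipartite p q m ->
  minn #|X| #|Y| < m.
Proof.
move=> p0 q0 Nsf Tsf Np Nq /(_ _ (bigraph_of_nbr_free Nsf Tsf)).
have [-> ->] := card_bigraph_of_nbr N => bound.
rewrite ltnNge leq_min; apply/negP => /andP [mX mY].
case: (bound mX mY); first exact: bigraph_of_nbr_biclique.
exact: bigraph_of_nbr_compl_biclique.
Qed.

Theorem theorem13 (p q : nat) (hp : 2 <= p) (hq : 2 <= q) :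
  is_bipartite_Ramsey_number P2P3_free_bipartite p q (maxn p q + p + q - 2).
Proof.
have p0 : 0 < p by lia.
have q0 : 0 < q by lia.
split=> [G Gfree cB cW | m bound].
  case: (classic (contains_induced G (biclique p p))) => [|Gp]; first by left.
  case: (classic (contains_induced (bicompl G) (biclique q q))) => [|Gq].
    by right.
  have [Nsf Tsf] := black_nbr_swap_free Gfree.
  have := bipartite_Ramsey_upper p0 q0 Nsf Tsf (black_nbr_biclique_free p0 Gp)
    (black_nbr_compl_biclique_free q0 Gq).
  by rewrite !card_sig ltnNge cW => /(_ cB).
have tsf k n : swap_free (transpose (@matching_nbr k n)).
  by move=> x y; rewrite !matching_nbr_transpose; apply: matching_nbr_swap_free.
have bf k n r : k.+2 = r -> biclique_free (@matching_nbr k n) r.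
  by move=> <-; apply: matching_nbr_biclique_free.
have [pq | qp] := leqP p q.
  (* Each part has [p - 2] full vertices and [2 * q - 1] matched ones, exactly one vertex short of
     the claimed value. *)
  pose n := p - 2 + (2 * q).-1.
  have := @bipartite_Ramsey_lower _ _ (@matching_nbr (p - 2) n) p q m p0 q0
    (@matching_nbr_swap_free _ _) (tsf _ _).
  rewrite !card_ord minnn => lower; suff : n < m by lia.
  by apply: lower => //; [apply: bf | apply: matching_nbr_compl_biclique_free]; lia.
pose n := q - 2 + (2 * p).-1.
have := @bipartite_Ramsey_lower _ _ (compl (@matching_nbr (q - 2) n)) p q m p0 q0
  (swap_free_compl (@matching_nbr_swap_free _ _)).
rewrite !card_ord minnn => lower; suff : n < m by lia.
apply: lower => //.
- have := swap_free_compl (tsf (q - 2) n).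
  (* Transposition commutes with complementation, again only pointwise. *)
  suff E i : transpose (compl (@matching_nbr (q - 2) n)) i =
      compl (transpose (@matching_nbr (q - 2) n)) i.
    by move=> sf i j; rewrite !E; apply: sf.
  by apply/setP => j; rewrite !inE.
- by apply: matching_nbr_compl_biclique_free; lia.
- by apply/biclique_free_compl2/bf; lia.
Qed.
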